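(* Let $t>0$. Then, for all $u>0$, $\mathbf P$-a.s. $$\mathbf P\left(\tau\le u\,|\,\mathcal F^P_t\right)=\mathbb I_{\{\tau\le t\wedge u\}}+\frac{\displaystyle\int_{(t,u]}\varphi_t(r,\beta_t)\,dF(r)}{\displaystyle\int_{(t,+\infty)}\varphi_t(v,\beta_t)\,dF(v)}\,\mathbb I_{\{t<\tau\}} .$$
   Context: Setting. $(\Omega,\mathcal F,\mathbf P)$ is a complete probability space and $\mathcal N_P$ is the collection of its $\mathbf P$-null sets. $W=(W_t)_{t\ge0}$ is a standard Brownian motion with continuous paths starting from $0$. $\tau:\Omega\to(0,\infty)$ is a strictly positive random variable with distribution function $F(t)=\mathbf P(\tau\le t)$. It is assumed throughout that $\tau$ and $W$ are independent and that $\tau$ is not a stopping time of the completed natural filtration of $W$ (so $\tau$ is not a.s. equal to a constant). The information process is $\beta_t:=W_t-\frac{t}{\tau\vee t}W_{\tau\vee t}$, $t\ge0$, and $\mathcal F^P_t:=\sigma(\beta_s,\,0\le s\le t)\vee\mathcal N_P$. Let $p(t,x,y):=(2\pi t)^{-1/2}\exp(-(x-y)^2/(2t))$, $x\in\mathbb R$, be the Gaussian density with variance $t$ and mean $y$, and for $t>0$, $r>0$, $x\in\mathbb R$ let $$\varphi_t(r,x):=\begin{cases}p\left(\frac{t(r-t)}{r},x,0\right),&0<t<r,\\ 0,& r\le t.\end{cases}$$ The interval $(t,u]$ is empty if $u\le t$; a term multiplied by an indicator is taken to be $0$ where the indicator vanishes. *)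

(* Defs.v *)
From HB Require Import structures.
From mathcomp Require Import all_boot all_order all_algebra.
From mathcomp Require Import all_classical all_reals all_analysis.

Set Implicit Arguments.
Unset Strict Implicit.
Unset Printing Implicit Defensive.

Import Order.TTheory GRing.Theory Num.Theory.
Import numFieldTopology.Exports numFieldNormedType.Exports.
Local Open Scope classical_set_scope.
Local Open Scope ring_scope.

Section sigma_algebras.
Context d (T : measurableType d) (R : realType) (P : probability T R).
Implicit Types (X : R -> T -> R) (F : R -> set (set T)).

Definition sigma_rv (Y : T -> R) : set (set T) :=
  preimage_set_system setT Y measurable.

Definition sigma_process X (I : set R) : set (set T) :=
  <<s \bigcup_(s in I) sigma_rv (X s) >>.

Definition completed_filtration X (t : R) : set (set T) :=
  <<s \bigcup_(s in `[0, t]) sigma_rv (X s) `|` P.-negligible >>.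

Definition stopping_time F (tau : T -> R) : Prop :=
  forall t, 0 <= t -> F t [set w | tau w <= t].

Definition independent_systems (G H : set (set T)) : Prop :=
  forall A B, G A -> H B -> P (A `&` B) = (P A * P B)%E.

(* Mutual independence of the whole family; the product rule for subfamilies is
   obtained by taking some of the [B i] equal to [setT]. *)
Definition mutually_independent n (Y : 'I_n -> T -> R) : Prop :=
  forall B : 'I_n -> set R, (forall i, measurable (B i)) ->
    P (\bigcap_i (Y i @^-1` B i)) = (\prod_(i < n) P (Y i @^-1` B i))%E.

(* [Y] is a version of P(A | G), for a sub-sigma-algebra G of the measurable
   sets. *)
Definition is_cond_prob (G : set (set T)) (A : set T) (Y : T -> R) : Prop :=
  [/\ sigma_rv Y `<=` G,
      P.-integrable setT (EFin \o Y) &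
      forall B, G B -> (\int[P]_(w in B) (Y w)%:E = P (A `&` B))%E].

End sigma_algebras.

(* The processes are indexed by [R]; only their values at times t >= 0 are
   constrained or used. [normal_prob m s] takes the standard deviation [s]. *)
Record standard_brownian d (T : measurableType d) (R : realType)
    (P : probability T R) (W : R -> T -> R) : Prop := StandardBrownian {
  brownian_measurable : forall t, 0 <= t -> measurable_fun setT (W t) ;
  brownian_start : forall w, W 0 w = 0 ;
  brownian_continuous :
    forall w, {within `[0, +oo[, continuous (fun t => W t w)} ;
  brownian_increments : forall s t, 0 <= s -> s < t ->
    forall B, measurable B ->
    P ((W t \- W s) @^-1` B) = normal_prob 0 (Num.sqrt (t - s)) B ;
  brownian_independent : forall n (t : nat -> R),
    0 <= t 0%N -> {homo t : i j / (i <= j)%N >-> i <= j} ->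
    mutually_independent P (fun i : 'I_n => W (t i.+1) \- W (t i)) }.

Section distribution_function.
Context d (T : measurableType d) (R : realType) (P : probability T R).
Variable X : {RV P >-> R}.

Definition distribution_function (t : R) : R := fine (cdf X t).

Let distribution_function_nd : nondecreasing distribution_function.
Proof. by move=> *; rewrite fine_le ?fin_num_measure// cdf_nondecreasing. Qed.

Let distribution_function_rc : right_continuous distribution_function.
Proof.
move=> a; apply: fine_cvg.
by rewrite fineK ?fin_num_measure//; exact: cdf_right_continuous.
Qed.

HB.instance Definition _ := isCumulative.Build R _ R distribution_function
  distribution_function_nd distribution_function_rc.

End distribution_function.

Definition gauss_density {R : realType} (t x y : R) : R :=
  (Num.sqrt (2 * pi * t))^-1 * expR (- (x - y) ^+ 2 / (2 * t)).

Definition phi {R : realType} (t r x : R) : R :=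
  if 0 < t < r then gauss_density (t * (r - t) / r) x 0 else 0.

Definition information_process (T : Type) (R : realType) (W : R -> T -> R)
    (tau : T -> R) (t : R) (w : T) : R :=
  W t w - t / Num.max (tau w) t * W (Num.max (tau w) t) w.

(* Main.v *)
Require Import Defs.
From HB Require Import structures.
From mathcomp Require Import all_boot all_order all_algebra.
From mathcomp Require Import all_classical all_reals all_analysis.
From mathcomp Require Import measurable_realfun ring.
Import Order.TTheory GRing.Theory Num.Theory.
Import numFieldTopology.Exports numFieldNormedType.Exports.
Local Open Scope classical_set_scope.
Local Open Scope ring_scope.

Set Implicit Arguments.
Unset Strict Implicit.
Unset Printing Implicit Defensive.

(** While the information process beta has not been absorbed at 0, that is
    on {t < tau}, its past splits as
      beta_s = b_s + (s / t) * beta_t  for s <= t,  b_s = W_s - (s / t) * W_t,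
    because beta is then a Brownian bridge of length tau, and a bridge of
    length tau restricted to [0, t] is a bridge b of length t plus a linear
    drift. The bridge b is independent of (W_r)_(r >= t), and tau is
    independent of W, so b is independent of (tau, beta_t) on {t < tau}. Hence
    the past of beta says nothing more about tau than beta_t does.

    Given tau = r > t, the variable beta_t is a centred normal variable of
    variance t * (r - t) / r, whose density is [phi t r]. Integrating over r,
    the event {tau in B} intersected with an event E of sigma(b) gives beta_t
    the density P(E) * int_B phi t r x dF(r) ([joint_density]), and the ratio
    of the densities for B = (t, u] and B = (t, +oo) is the conditional
    probability on {t < tau} by Bayes' rule ([bayes_conditional_density],
    [integral_posterior]). On {tau <= t} the process is at 0, whereas beta_s is
    almost surely nonzero on {s < tau}; so for 0 < s <= t the event {tau <= s}
    belongs to the completed sigma-algebra of beta ([filtration_tau_le]), and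
    tau is known there.

    The independence of b and W_t is obtained from one-dimensional normal laws
    only: if X and Y are independent centred normal variables of variances a
    and b, then X + Y and X - a / (a + b) * (X + Y) are again independent and
    normal ([normal_prob_rotation]). Taking for X the value of W at a time v and
    for Y an increment after v, this adds one time to a finite list of times
    ([bridge_independent]). The random time tau is replaced by a fixed r
    through Fubini's theorem on the product of the time axis and the path space
    ([joint_law]), which applies since continuity of the paths makes
    (r, w) |-> W_r(w) jointly measurable ([measurable_path]). *)

(** * Integrals with respect to translated measures and densities *)

(** The measure structure of a pushforward depends on a measurability proof,
    which is an argument here so that the structure can be named. *)
Definition pushforward_measure d1 d2 (T1 : measurableType d1)
    (T2 : measurableType d2) (R : realFieldType)
    (m : {measure set T1 -> \bar R}) (f : T1 -> T2)
    (mf : measurable_fun setT f) : {measure set T2 -> \bar R} :=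
  measure_function_pushforward__canonical__measure_function_Measure m mf.

Section translation.
Context {R : realType}.
Notation mu := (@lebesgue_measure R).

Let shift (c : R) : measurableTypeR R -> measurableTypeR R := fun x => c + x.

Let measurable_shift c : measurable_fun setT (shift c).
Proof. exact: measurable_funD. Qed.

Lemma lebesgue_measure_shift (c : R) (A : set R) : measurable A ->
  pushforward mu (shift c) A = mu A.
Proof.
move=> mA; apply/esym.
apply: (@lebesgue_measure_unique _ (pushforward mu (shift c)) _ A mA).
move=> _ [[a b]] _ <-.
have E : shift c @^-1` [set` `]a, b]] = [set` `]a - c, b - c]].
  apply/funext => x; apply/propext.
  by rewrite /preimage /= !in_itv/= ltrBlDl lerBrDl.
transitivity (mu `]a - c, b - c]); last by congr (mu _).
rewrite /= !lebesgue_measure_itv/= !lte_fin ltrD2r.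
by case: ifP => // _; congr EFin; ring.
Qed.

Lemma ge0_integral_shift (c : R) (f : R -> \bar R) :
  measurable_fun setT f -> (forall x, 0 <= f x)%E ->
  (\int[mu]_x f (c + x)%R = \int[mu]_x f x)%E.
Proof.
move=> mf f0.
transitivity (\int[pushforward mu (shift c)]_x f x)%E.
  by rewrite (ge0_integral_pushforward (measurable_shift c))//= => x _.
apply: eq_measure_integral => A mA _; exact: lebesgue_measure_shift.
Qed.

End translation.

Section density.
Local Open Scope ereal_scope.
Context d (T : measurableType d) (R : realType).
Variables (mu nu : {measure set T -> \bar R}) (g : T -> R).
Hypotheses (mg : measurable_fun setT g) (g0 : forall x, (0 <= g x)%R).
Hypothesis nuE : forall A, measurable A -> nu A = \int[mu]_(x in A) (g x)%:E.

Import HBNNSimple.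

Let integral_nnsfun_density (h : {nnsfun T >-> R}) :
  \int[nu]_x (h x)%:E = \int[mu]_x ((h x)%:E * (g x)%:E).
Proof.
have mgE : measurable_fun setT (EFin \o g) by exact/measurable_EFinP.
under eq_integral do rewrite fimfunE -fsumEFin//.
rewrite ge0_integral_fsum//; last 2 first.
  - by move=> y; exact/measurable_EFinP/measurable_funM.
  - by move=> y x _; rewrite nnfun_muleindic_ge0.
transitivity (\sum_(k \in range h)
    \int[mu]_x ((k * \1_(h @^-1` [set k]) x)%:E * (g x)%:E)).
  apply: eq_fsbigr => r; rewrite inE => -[z _ <-{r}].
  rewrite integralZl_indic_nnsfun// integral_indic//= setIT nuE//.
  rewrite integral_mkcond/= -ge0_integralZl//; last 3 first.
  - apply/(measurable_restrictT _ _).1 => //; exact: measurable_funTS.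
  - by move=> x _; rewrite /patch; case: ifP; rewrite ?lee_fin.
  - by rewrite lee_fin.
  apply: eq_integral => x _; rewrite /patch/= indicE.
  by case: ifP => _; rewrite ?mulr1 ?mulr0 ?mul0e ?mule0.
rewrite -ge0_integral_fsum//.
- apply: eq_integral => x _; rewrite -ge0_mule_fsuml; last first.
    by move=> r; rewrite nnfun_muleindic_ge0.
  by rewrite fsumEFin// -fimfunE.
- move=> r; apply: emeasurable_funM => //.
  exact/measurable_EFinP/measurable_funM.
- move=> r x _; apply: mule_ge0; last by rewrite lee_fin.
  by rewrite EFinM nnfun_muleindic_ge0.
Qed.

(** Clear for simple functions by linearity; monotone convergence extends it
    to every nonnegative function. *)
Lemma ge0_integral_density (f : T -> \bar R) :
  measurable_fun setT f -> (forall x, 0 <= f x) ->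
  \int[nu]_x f x = \int[mu]_x (f x * (g x)%:E).
Proof.
move=> mf f0.
have mgE : measurable_fun setT (EFin \o g) by exact/measurable_EFinP.
pose f_ := nnsfun_approx measurableT mf.
transitivity (limn (fun n => \int[nu]_x (f_ n x)%:E)).
  rewrite -monotone_convergence//.
  - apply: eq_integral => y _; apply/esym/cvg_lim => //.
    exact: cvg_nnsfun_approx.
  - by move=> n; exact/measurable_EFinP/measurable_funP.
  - by move=> n y _; rewrite lee_fin.
  - by move=> y _ m n mn; rewrite lee_fin; exact/lefP/nd_nnsfun_approx.
under eq_fun do rewrite integral_nnsfun_density.
rewrite -monotone_convergence//.
- apply: eq_integral => y _; apply/cvg_lim => //.
  by apply: cvgeZr => //; apply: cvg_nnsfun_approx.
- move=> n; apply: emeasurable_funM => //.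
  exact/measurable_EFinP/measurable_funP.
- by move=> n y _; rewrite mule_ge0// lee_fin.
- move=> y _ m n mn; rewrite lee_wpmul2r ?lee_fin//.
  exact/lefP/nd_nnsfun_approx.
Qed.

End density.

(** * Rotation of independent normal variables *)

Section shear.
Context {R : realType}.
Notation mu := (@lebesgue_measure R).

(** The linear map (x, y) |-> (x + y, x - c * (x + y)) preserves the Lebesgue
    measure of the plane: it is a translation of y for fixed x followed, once
    the integrals are exchanged, by a translation of x. *)
Lemma ge0_integral_shear (c : R) (h : R * R -> \bar R) :
  measurable_fun setT h -> (forall z, 0 <= h z)%E ->
  (\int[mu]_x \int[mu]_y h (x + y, x - c * (x + y))%R =
   \int[mu]_x \int[mu]_y h (x, y))%E.
Proof.
move=> mh h0.
have mf : measurable_fun setT (fun z : R * R => h (z.2, z.1 - c * z.2)).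
  apply: (measurableT_comp mh); apply: measurable_fun_pair => /=.
    exact: measurable_snd.
  apply: measurable_funB; first exact: measurable_fst.
  by apply: measurable_funM => //; exact: measurable_snd.
transitivity (\int[mu]_x \int[mu]_y h (y, (x - c * y)%R))%E.
  apply: eq_integral => x _.
  apply: (@ge0_integral_shift _ x (fun y => h (y, x - c * y))) => //.
  exact: (measurableT_comp mf (pair1_measurable x)).
rewrite (@fubini_tonelli _ _ _ _ R mu mu (fun z => h (z.2, z.1 - c * z.2)) mf)//.
apply: eq_integral => y _.
under eq_integral do rewrite addrC.
apply: (@ge0_integral_shift _ (- (c * y)) (fun x => h (y, x))) => //.
exact: (measurableT_comp mh (pair1_measurable y)).
Qed.

End shear.

Section normal_density_rotation.
Context {R : realType}.
Implicit Types a b x y : R.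

Lemma normal_pdf_sqrt a x : 0 < a ->
  normal_pdf 0 (Num.sqrt a) x =
  (Num.sqrt (a * pi *+ 2))^-1 * expR (- x ^+ 2 / (a *+ 2)).
Proof.
move=> a0; rewrite normal_pdfE ?gt_eqF ?sqrtr_gt0// /normal_peak /normal_fun.
by rewrite subr0 sqr_sqrtr// ltW.
Qed.

(** With s = x + y and z = x - a / (a + b) * s, completing the square gives
    x^2 / a + y^2 / b = s^2 / (a + b) + z^2 * (a + b) / (a * b). *)
Lemma normal_pdf_rotation a b x y : 0 < a -> 0 < b ->
  normal_pdf 0 (Num.sqrt a) x * normal_pdf 0 (Num.sqrt b) y =
  normal_pdf 0 (Num.sqrt (a + b)) (x + y) *
  normal_pdf 0 (Num.sqrt (a * b / (a + b))) (x - a / (a + b) * (x + y)).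
Proof.
move=> a0 b0; have ab0 : 0 < a + b by exact: addr_gt0.
have pi0 := @pi_gt0 R.
have pos2 (c : R) : 0 < c -> 0 <= c * pi *+ 2.
  by move=> c0; apply/mulrn_wge0/ltW/mulr_gt0.
have v0 : 0 < a * b / (a + b) by rewrite divr_gt0// mulr_gt0.
rewrite !normal_pdf_sqrt// mulrACA [RHS]mulrACA -!expRD -!invfM -!sqrtrM ?pos2//.
congr (_^-1 * expR _); last by field; rewrite !gt_eqF.
by congr (Num.sqrt _); field; rewrite gt_eqF.
Qed.

End normal_density_rotation.

Section normal_rotation.
Context {R : realType}.
Notation mu := (@lebesgue_measure R).
Local Open Scope ereal_scope.

Definition rotated_rectangle (c : R) (A B : set R) : set (R * R) :=
  [set z | A (z.1 + z.2)%R /\ B (z.1 - c * (z.1 + z.2))%R].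

Lemma measurable_rotated_rectangle c A B : measurable A -> measurable B ->
  measurable (rotated_rectangle c A B).
Proof.
move=> mA mB; rewrite (_ : rotated_rectangle c A B =
    (fun z : R * R => z.1 + z.2)%R @^-1` A `&`
    (fun z : R * R => z.1 - c * (z.1 + z.2))%R @^-1` B)//.
have m1 : measurable_fun setT (fun z : R * R => z.1 + z.2)%R.
  by apply: measurable_funD; [exact: measurable_fst|exact: measurable_snd].
have m2 : measurable_fun setT (fun z : R * R => z.1 - c * (z.1 + z.2))%R.
  apply: measurable_funB; first exact: measurable_fst.
  exact: measurable_funM.
by apply: measurableI; rewrite -[X in measurable X]setTI;
  [apply: m1|apply: m2].
Qed.

(** If X and Y are independent centred normal variables, then X + Y and the
    residual of the regression of X on X + Y are uncorrelated, hence
    independent; their variances are a + b and a * b / (a + b). *)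
Lemma normal_prob_rotation (a b : R) (A B : set R) : (0 < a)%R -> (0 < b)%R ->
  measurable A -> measurable B ->
  (normal_prob 0 (Num.sqrt a) \x normal_prob 0 (Num.sqrt b))
    (rotated_rectangle (a / (a + b)) A B) =
  normal_prob 0 (Num.sqrt (a + b)) A *
  normal_prob 0 (Num.sqrt (a * b / (a + b))) B.
Proof.
move=> a0 b0 mA mB.
set D := (X in _ X = _).
have mD : measurable D by exact: measurable_rotated_rectangle.
pose pa := @normal_pdf R 0 (Num.sqrt a).
pose pab := @normal_pdf R 0 (Num.sqrt (a + b)).
pose pv := @normal_pdf R 0 (Num.sqrt (a * b / (a + b))).
pose h (z : R * R) := ((\1_A z.1 * pab z.1) * (\1_B z.2 * pv z.2))%R%:E.
have mfA (C : set R) s : measurable C ->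
    measurable_fun setT (fun x => \1_C x * normal_pdf 0 s x)%R.
  by move=> mC; apply: measurable_funM => //; exact: measurable_normal_pdf.
have mh : measurable_fun setT h.
  apply/measurable_EFinP; apply: measurable_funM.
    exact: (measurableT_comp (mfA _ _ mA) measurable_fst).
  exact: (measurableT_comp (mfA _ _ mB) measurable_snd).
have h0 z : 0 <= h z.
  by rewrite lee_fin !mulr_ge0// normal_pdf_ge0.
transitivity (\int[mu]_x \int[mu]_y h (x + y, x - a / (a + b) * (x + y))%R).
  rewrite /= /product_measure1.
  rewrite (@ge0_integral_density _ _ R mu (normal_prob 0 (Num.sqrt a)) pa)//.
  all: try exact: measurable_normal_pdf.
  all: try exact: normal_pdf_ge0.
  all: try exact: measurable_fun_xsection.
  apply: eq_integral => x _ /=.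
  rewrite {1}/normal_prob integral_mkcond/= muleC -ge0_integralZl//=; first last.
  - by rewrite lee_fin normal_pdf_ge0.
  - by move=> y _; rewrite /patch; case: ifP => _//; rewrite lee_fin normal_pdf_ge0.
  - apply/(measurable_restrictT _ _).1 => //; first exact: measurable_xsection.
    apply: measurable_funTS; apply/measurable_EFinP; exact: measurable_normal_pdf.
  apply: eq_integral => y _; rewrite /patch /h/=.
  rewrite mulrACA -normal_pdf_rotation// !indicE.
  rewrite (_ : (y \in xsection D x) =
    ((x + y)%R \in A) && ((x - a / (a + b) * (x + y))%R \in B)).
    by do 2 case: (_ \in _); rewrite /= ?mulr1 ?mulr0 ?mul0r ?mule0 ?mul1r.
  by apply/idP/andP; rewrite /xsection !inE/= ?inE.
rewrite ge0_integral_shear//.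
have Ni (C : set R) s : measurable C ->
    normal_prob 0 s C = \int[mu]_x (\1_C x * normal_pdf 0 s x)%:E.
  move=> mC; rewrite /normal_prob integral_mkcond; apply: eq_integral => x _.
  by rewrite /patch indicE; case: ifP; rewrite ?mul1r ?mul0r.
rewrite (Ni A)// (Ni B)// muleC -ge0_integralZl//; first last.
- by apply: integral_ge0 => x _; rewrite lee_fin mulr_ge0// normal_pdf_ge0.
- by move=> x _; rewrite lee_fin mulr_ge0// normal_pdf_ge0.
- by apply/measurable_EFinP; apply: mfA.
apply: (@eq_integral _ _ R mu) => x _; rewrite muleC -ge0_integralZl//; first last.
- by rewrite lee_fin mulr_ge0// normal_pdf_ge0.
- by move=> y _; rewrite lee_fin mulr_ge0// normal_pdf_ge0.
- by apply/measurable_EFinP; apply: mfA.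
Qed.

End normal_rotation.

Section rectangles.
Local Open Scope ereal_scope.
Context d1 d2 (T1 : measurableType d1) (T2 : measurableType d2) (R : realType).
Variables (p1 : probability T1 R) (p2 : probability T2 R).
Variables (m : {measure set (T1 * T2) -> \bar R}) (k : {nonneg R}).
Hypothesis mE : forall A B, measurable A -> measurable B ->
  m (A `*` B) = k%:num%:E * (p1 A * p2 B).

(** The scale k accommodates the restriction of a probability to an event of
    probability k that is independent of both coordinates. *)
Lemma scaled_product_measure_unique D : measurable D ->
  m D = k%:num%:E * (p1 \x p2) D.
Proof.
pose G : set (set (T1 * T2)) :=
  [set A `*` B | A in measurable & B in measurable].
move=> mD.
apply: (@measure_unique _ R _ G (fun=> setT) _ _ _ _ m (mscale k (p1 \x p2))).
- by rewrite measurable_prod_measurableType.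
- move=> _ _ [A mA [B mB <-]] [A' mA' [B' mB' <-]].
  exists (A `&` A'); first exact: measurableI.
  by exists (B `&` B'); [exact: measurableI|rewrite setXI].
- by move=> _; exists setT => //; exists setT => //; rewrite setXTT.
- by rewrite bigcup_const.
- move=> _ [A mA [B mB <-]]; rewrite mE// /mscale.
  by congr (_ * _); exact/esym/product_measure1E.
- move=> _; rewrite -setXTT mE// !probability_setT !mule1 ltry//.
- exact: mD.
Qed.

End rectangles.

Section independent_rotation.
Context d (T : measurableType d) (R : realType) (P : probability T R).
Local Open Scope ereal_scope.

(** The event E carries what is already known to be independent of (X, Y); it
    remains independent of the rotated pair. *)
Lemma independent_normal_rotation (E : set T) (X Y : T -> R) (a b : R) :
  (0 < a)%R -> (0 < b)%R -> measurable E ->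
  measurable_fun setT X -> measurable_fun setT Y ->
  (forall A B, measurable A -> measurable B ->
    P (E `&` (X @^-1` A `&` Y @^-1` B)) =
    P E * (normal_prob 0 (Num.sqrt a) A * normal_prob 0 (Num.sqrt b) B)) ->
  forall A B, measurable A -> measurable B ->
    P (E `&` ((fun w => X w + Y w)%R @^-1` A `&`
              (fun w => X w - a / (a + b) * (X w + Y w))%R @^-1` B)) =
    P E * (normal_prob 0 (Num.sqrt (a + b)) A *
           normal_prob 0 (Num.sqrt (a * b / (a + b))) B).
Proof.
move=> a0 b0 mE mX mY XY A B mA mB.
(* Normal laws are measures on the copy [measurableTypeR R] of the real line,
   which has the same measurable sets but another display. *)
pose XY' : T -> measurableTypeR R * measurableTypeR R := fun w => (X w, Y w).
have mXY : measurable_fun setT XY'.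
  by apply: measurable_fun_pair; [exact: mX|exact: mY].
have PE : P E = (fine (P E))%:E by rewrite fineK// fin_num_measure.
have PE0 : (0 <= fine (P E))%R by exact: fine_ge0.
rewrite PE -(normal_prob_rotation a0 b0 mA mB).
set D := (X in (_ \x _) X).
have mD : measurable D by exact: measurable_rotated_rectangle.
have H := @scaled_product_measure_unique _ _ _ _ R
  (normal_prob 0 (Num.sqrt a)) (normal_prob 0 (Num.sqrt b))
  (pushforward_measure (mrestr P mE) mXY) (NngNum PE0).
rewrite -[RHS]H//.
  by rewrite /= /pushforward /mrestr setIC; congr (P _).
move=> A' B' mA' mB'.
rewrite /= /pushforward /mrestr/= -PE -XY//; congr (P _).
by rewrite setIC.
Qed.

End independent_rotation.

(** * Independence and generating pi-systems *)

Section independence.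
Context d (T : measurableType d) (R : realType) (P : probability T R).
Local Open Scope ereal_scope.

Lemma independent_pi_system (C : set (set T)) (F : set T) :
  C `<=` measurable -> setI_closed C -> measurable F ->
  (forall E, C E -> P (E `&` F) = P E * P F) ->
  forall E, <<s C >> E -> P (E `&` F) = P E * P F.
Proof.
move=> mC IC mF CF E sE.
(* The uniqueness theorem for measures asks for a pi-system covering the space. *)
pose G := C `|` [set setT].
have PF : P F = (fine (P F))%:E by rewrite fineK// fin_num_measure.
have PF0 : (0 <= fine (P F))%R by exact: fine_ge0.
rewrite PF muleC.
apply: (@g_sigma_algebra_measure_unique _ _ _ G _ (fun=> setT) _ _
  (mrestr P mF) (mscale (NngNum PF0) P)).
- by move=> A [/mC//|->].
- by move=> _; right.
- by rewrite bigcup_const.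
- move=> A B [CA|->] [CB|->]; rewrite ?setIT ?setTI;
    [left; exact: IC|left|left|right] => //.
- move=> A [CA|->].
    transitivity (P A * P F); [exact: CF|by rewrite muleC {1}PF].
  transitivity (P F); first by rewrite -[in RHS](setTI F).
  by rewrite {1}PF /= /mscale/= probability_setT mule1.
- by move=> _; rewrite /= /mrestr setTI -ge0_fin_numE// fin_num_measure.
- by apply: sub_sigma_algebra2 sE => A CA; left.
Qed.

Lemma sigma_rvP (C : set (set T)) (Y : T -> R) :
  sigma_rv Y `<=` <<s C >> <->
  measurable_fun setT (Y : g_sigma_algebraType C -> R).
Proof.
split=> [H mT B mB|H _ [B mB <-]]; first by apply: H; exists B.
by apply: H.
Qed.

Lemma sigma_process_min (X : R -> T -> R) (I : set R) (C : set (set T)) :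
  (forall s, I s -> measurable_fun setT (X s : g_sigma_algebraType C -> R)) ->
  sigma_process X I `<=` <<s C >>.
Proof.
move=> H; apply: smallest_sub; first exact: smallest_sigma_algebra.
by move=> A [s Is XA]; apply: ((sigma_rvP _ _).2 (H s Is)).
Qed.

Lemma measurable_sigma_process (X : R -> T -> R) (I : set R) s : I s ->
  measurable_fun setT
    (X s : g_sigma_algebraType (\bigcup_(r in I) sigma_rv (X r)) -> R).
Proof.
by move=> Is; apply/sigma_rvP => A XA; apply: sub_sigma_algebra; exists s.
Qed.

Lemma sigma_process_measurable (X : R -> T -> R) (I : set R) :
  (forall s, I s -> measurable_fun setT (X s)) ->
  sigma_process X I `<=` measurable.
Proof.
move=> mX; apply: smallest_sub; first exact: sigma_algebra_measurable.
by move=> _ [s Is [B mB <-]]; exact: mX.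
Qed.

(** The events that depend on finitely many times form a pi-system. The times
    may be taken in decreasing order, which suits an induction that removes
    the latest one. *)
Lemma independent_sigma_process (X : R -> T -> R) (I : set R) (F : set T) :
  (forall s, I s -> measurable_fun setT (X s)) -> measurable F ->
  (forall L : seq R, sorted >%R L -> (forall s, s \in L -> I s) ->
    forall E, sigma_process X [set` L] E -> P (E `&` F) = P E * P F) ->
  forall E, sigma_process X I E -> P (E `&` F) = P E * P F.
Proof.
move=> mX mF H E sE.
pose C := [set E | exists2 L : seq R,
  (forall s, s \in L -> I s) & sigma_process X [set` L] E].
have CF A : C A -> P (A `&` F) = P A * P F.
  move=> [L LI sA].
  apply: (H (rev (sort <=%R (undup L)))).
  - by rewrite rev_sorted sort_lt_sorted undup_uniq.
  - by move=> s; rewrite mem_rev mem_sort mem_undup => /LI.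
  - rewrite (_ : [set` _] = [set` L])//.
    by apply/seteqP; split=> x /=; rewrite mem_rev mem_sort mem_undup.
apply: (@independent_pi_system C) => //.
- move=> A [L LI]; apply: sigma_process_measurable => s /LI; exact: mX.
- move=> A B [L LI sA] [M MI sB]; exists (L ++ M).
    by move=> s; rewrite mem_cat => /orP[/LI|/MI].
  have LM : forall N : seq R, (forall s, s \in N -> s \in L ++ M) ->
      sigma_process X [set` N] `<=` sigma_process X [set` L ++ M].
    move=> N NLM; apply: sub_sigma_algebra2 => D [s /= /NLM sN XD]; by exists s.
  have sA' : sigma_process X [set` L ++ M] A.
    by apply: (LM L) => // s; rewrite mem_cat => ->.
  have sB' : sigma_process X [set` L ++ M] B.
    by apply: (LM M) => // s; rewrite mem_cat => ->; rewrite orbT.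
  exact: (@measurableI _ (g_sigma_algebraType
    (\bigcup_(s in [set` L ++ M]) sigma_rv (X s))) _ _ sA' sB').
- move: sE; apply: sub_sigma_algebra2 => A [s Is XA]; exists [:: s].
    by move=> r; rewrite inE => /eqP ->.
  by apply: sub_sigma_algebra; exists s => //=; rewrite inE.
Qed.

(** The rectangles whose last side is the whole line form a pi-system that
    generates the sigma-algebra of the other variables. *)
Lemma mutually_independent_last n (Y : 'I_n.+1 -> T -> R) (B : set R) :
  (forall i, measurable_fun setT (Y i)) -> mutually_independent P Y ->
  measurable B ->
  forall E, <<s \bigcup_(i in [set i | i != ord_max]) sigma_rv (Y i) >> E ->
  P (E `&` Y ord_max @^-1` B) = P E * P (Y ord_max @^-1` B).
Proof.
move=> mY Yi mB E sE.
have mYB i A : measurable A -> measurable (Y i @^-1` A).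
  by move=> mA; rewrite -[X in measurable X]setTI; exact: mY.
pose C := [set E | exists D : 'I_n.+1 -> set R, [/\ forall i, measurable (D i),
  D ord_max = setT & E = \bigcap_i (Y i @^-1` D i)]].
apply: (@independent_pi_system C).
- move=> _ [D [mD _ ->]].
  by apply: fin_bigcap_measurable => // i _; exact: mYB.
- move=> _ _ [D1 [mD1 D1T ->]] [D2 [mD2 D2T ->]].
  exists (fun i => D1 i `&` D2 i); split.
  + by move=> i; exact: measurableI.
  + by rewrite D1T D2T setIT.
  + apply/seteqP; split=> [w [H1 H2] i _|w H].
      by split; [exact: H1|exact: H2].
    by split=> i _; case: (H i I).
- exact: mYB.
- move=> _ [D [mD DT ->]].
  pose D' i := if i == ord_max then B else D i.
  have mD' i : measurable (D' i) by rewrite /D'; case: ifP.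
  have -> : \bigcap_i (Y i @^-1` D i) `&` Y ord_max @^-1` B =
      \bigcap_i (Y i @^-1` D' i).
    apply/seteqP; split=> [w [H1 H2] i _|w H].
      by rewrite /D'; case: eqP => [->//|_]; exact: H1.
    split=> [i _|]; last by have := H ord_max I; rewrite /D' eqxx.
    by have := H i I; rewrite /D'; case: eqP => [->|//]; rewrite DT.
  rewrite !Yi// (bigD1 ord_max)//= [in RHS](bigD1 ord_max)//= DT preimage_setT.
  rewrite probability_setT mul1e muleC {2}/D' eqxx; congr (_ * _).
  by apply: eq_bigr => i /negbTE im; rewrite /D' im.
- move: sE; apply: sub_sigma_algebra2 => _ [i /= im [A mA <-]].
  exists (fun j => if j == i then A else setT); split.
  + by move=> j; case: ifP.
  + by rewrite eq_sym (negbTE im).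
  + rewrite setTI; apply/seteqP; split=> [w Aw j _|w /(_ i I)]; last first.
      by rewrite eqxx.
    by case: eqP => [->|].
Qed.

End independence.

(** * The Brownian bridge and its independence of the future *)

(** The length [t] of the bridge comes first, the current time [s] second: the
    information process at time t < tau is [bridge W tau t]. *)
Definition bridge (R : realType) (T : Type) (W : R -> T -> R) (t s : R)
    (w : T) : R :=
  W s w - s / t * W t w.

Section brownian.
Context d (T : measurableType d) (R : realType) (P : probability T R).
Variables (W : R -> T -> R) (bW : standard_brownian P W).

Let mW t : 0 <= t -> measurable_fun setT (W t).
Proof. exact: (brownian_measurable bW). Qed.

(** For finitely many times of [0, v], the values of W are partial sums of
    increments that are mutually independent of the increment from v to s. *)
Lemma brownian_increment_past (v s : R) (B : set R) : 0 <= v -> v < s ->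
  measurable B -> forall E, sigma_process W `[0, v] E ->
  P (E `&` (fun w => W s w - W v w) @^-1` B) =
  (P E * normal_prob 0 (Num.sqrt (s - v)) B)%E.
Proof.
move=> v0 vs mB E sE.
have s0 : (0 <= s) by rewrite (le_trans v0)// ltW.
rewrite -(brownian_increments bW v0 vs mB).
have mD : measurable_fun setT (W s \- W v).
  by apply: measurable_funB; exact: mW.
have mF : measurable ((W s \- W v) @^-1` B).
  by rewrite -[X in measurable X]setTI; exact: mD.
move: sE; apply: (independent_sigma_process _ mF).
  by move=> r /=; rewrite in_itv/= => /andP[r0 _]; exact: mW.
move=> L sL L0v {}E sE.
(* The subdivision starts at 0, where W vanishes, goes through the times of L in
   increasing order, and its last increment is the one from v to s. *)
pose M := (0 :: rcons (rev L) v).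
have sM : sorted <=%R (rcons M s).
  have sM' : sorted <=%R M.
    rewrite /M/= rcons_path; apply/andP; split.
      rewrite path_min_sorted; last first.
        by apply/allP => x; rewrite mem_rev => /L0v/=; rewrite in_itv/= => /andP[].
      by rewrite rev_sorted; apply: sub_sorted sL => x y; exact: ltW.
    have := mem_last 0 (rev L); rewrite inE => /orP[/eqP -> //|].
    by rewrite mem_rev => /L0v/=; rewrite in_itv/= => /andP[].
  rewrite /M/= rcons_path; apply/andP; split; first exact: sM'.
  by rewrite last_rcons ltW.
pose n := size (rev L).
have szM : size M = n.+2 by rewrite /M/= size_rcons.
(* The default value s keeps the sequence nondecreasing past its end. *)
pose t i := nth s (rcons M s) i.
have ht : {homo t : i j / (i <= j)%N >-> (i <= j)}.
  move=> i j ij; have [jM|Mj] := ltnP j (size (rcons M s)).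
    apply: (sorted_leq_nth le_trans le_refl) => //; rewrite inE//.
    exact: leq_ltn_trans jM.
  rewrite /t [leRHS]nth_default//.
  have [iM|Mi] := ltnP i (size (rcons M s)); last by rewrite nth_default.
  have := @sorted_leq_nth _ _ le_trans le_refl s _ sM i (size M).
  rewrite !inE iM size_rcons leqnn -ltnS -(size_rcons M s) iM => /(_ isT isT isT).
  by rewrite [X in (_ <= X)]nth_rcons ltnn eqxx.
have t0 : (0 <= t 0%N) by rewrite /t.
have tge0 i : (0 <= t i) by apply: (le_trans t0); exact: ht.
pose Y := fun i : 'I_n.+2 => W (t i.+1) \- W (t i).
have mY i : measurable_fun setT (Y i) by apply: measurable_funB; exact: mW.
have := mutually_independent_last mY (brownian_independent bW (n:=n.+2) t0 ht) mB.
have -> : Y ord_max = W s \- W v.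
  rewrite /Y /t/=; congr (W _ \- W _).
    by rewrite nth_rcons size_rcons ltnn eqxx.
  by rewrite /= !nth_rcons size_rcons -/n ltnS leqnn ltnn eqxx.
apply; move: E sE; apply: sigma_process_min => r rL.
set C := \bigcup_(i in _) _.
have WC i : (i < n.+1)%N ->
    measurable_fun setT (W (t i) : g_sigma_algebraType C -> R).
  elim: i => [_|i IH im].
    rewrite (_ : W _ = cst 0); first exact: measurable_cst.
    by apply/funext => w; rewrite /t/= (brownian_start bW).
  have im' : (i < n.+2)%N by rewrite ltnW// ltnW.
  rewrite (_ : W (t i.+1) = (fun w => W (t i) w + Y (Ordinal im') w)); last first.
    by apply/funext => w; rewrite /Y/= addrC subrK.
  apply: measurable_funD; first by apply: IH; exact: ltnW.
  apply/sigma_rvP => A YA; apply: sub_sigma_algebra; exists (Ordinal im') => //=.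
  by rewrite -val_eqE/= neq_ltn (ltnW im).
move: rL; rewrite /= -(mem_rev L) => rL.
rewrite (_ : r = t (index r (rev L)).+1).
  by apply: WC; rewrite ltnS index_mem.
by rewrite /t/M/= !nth_rcons size_rcons ltnS index_size !index_mem rL nth_index.
Qed.

End brownian.

Section brownian_bridge.
Context d (T : measurableType d) (R : realType) (P : probability T R).
Variables (W : R -> T -> R) (bW : standard_brownian P W).

Let mW t : 0 <= t -> measurable_fun setT (W t).
Proof. exact: (brownian_measurable bW). Qed.

Let mWB t B : 0 <= t -> measurable B -> measurable (W t @^-1` B).
Proof. by move=> t0 mB; rewrite -[X in measurable X]setTI; exact: mW. Qed.

Let past_measurable v : sigma_process W `[0, v] `<=` measurable.
Proof.
apply: sigma_process_measurable => s /=; rewrite in_itv/= => /andP[s0 _].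
exact: mW.
Qed.

Lemma brownian_marginal t A : 0 < t -> measurable A ->
  P (W t @^-1` A) = normal_prob 0 (Num.sqrt t) A.
Proof.
move=> t0 mA; rewrite -[in RHS](subr0 t).
rewrite -(brownian_increments bW (lexx 0) t0 mA); congr (P _).
rewrite (_ : W t \- W 0 = W t)//; apply/funext => w.
by rewrite /= (brownian_start bW) subr0.
Qed.

Lemma measurable_bridge t s : 0 <= t -> 0 <= s ->
  measurable_fun setT (bridge W t s).
Proof.
move=> t0 s0; apply: measurable_funB; first exact: mW.
by apply: measurable_funM => //; exact: mW.
Qed.

(** The rotation of normal variables, applied to W_v and W_s - W_v, whose sum is
    W_s and whose residual is the bridge of length s at time v. *)
Lemma bridge_rotation v s E : 0 < v -> v < s -> sigma_process W `[0, v] E ->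
  (forall A, measurable A ->
    P (E `&` W v @^-1` A) = (P E * normal_prob 0 (Num.sqrt v) A)%E) ->
  forall A B, measurable A -> measurable B ->
    P (E `&` (W s @^-1` A `&` bridge W s v @^-1` B)) =
    (P E * (normal_prob 0 (Num.sqrt s) A *
            normal_prob 0 (Num.sqrt (v * (s - v) / s)) B))%E.
Proof.
move=> v0 vs vE EW A B mA mB.
have sv0 : 0 < s - v by rewrite subr_gt0.
have s0 := lt_trans v0 vs.
have mD : measurable_fun setT (fun w => W s w - W v w).
  by apply: measurable_funB; apply: mW; exact: ltW.
have vsE : v + (s - v) = s by rewrite addrC subrK.
have EWD A' B' : measurable A' -> measurable B' ->
    P (E `&` (W v @^-1` A' `&` (fun w => W s w - W v w) @^-1` B')) =
    (P E * (normal_prob 0 (Num.sqrt v) A' *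
            normal_prob 0 (Num.sqrt (s - v)) B'))%E.
  move=> mA' mB'; rewrite setIA (brownian_increment_past bW (ltW v0) vs mB').
    by rewrite EW// muleA.
  apply: (@measurableI _
    (g_sigma_algebraType (\bigcup_(r in `[0, v]) sigma_rv (W r)))).
    exact: vE.
  apply: sub_sigma_algebra; exists v; first by rewrite /= in_itv/= lexx ltW.
  by exists A' => //; rewrite setTI.
have := independent_normal_rotation v0 sv0 (past_measurable vE)
  (mW (ltW v0)) mD EWD mA mB.
rewrite vsE (_ : (fun w => W v w + (W s w - W v w)) = W s); last first.
  by apply/funext => w; rewrite addrC subrK.
rewrite (_ : (fun w => W v w - _ * _) = bridge W s v)//.
by apply/funext => w; rewrite /bridge [W v w + (_ - _)]addrC subrK.
Qed.

Lemma bridge_past t I : (forall s, I s -> 0 <= s <= t) ->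
  sigma_process (bridge W t) I `<=` sigma_process W `[0, t].
Proof.
move=> I0t; apply: sigma_process_min => s /I0t /andP[s0 st].
apply: measurable_funB; last apply: measurable_funM => //.
  by apply: measurable_sigma_process; rewrite /= in_itv/= s0 st.
by apply: measurable_sigma_process; rewrite /= in_itv/= lexx (le_trans s0).
Qed.

(** Induction on the list of times, latest time v first: the bridge of length t
    is determined at the earlier times r by the bridge of length v and its own
    value at v, through b^t_r = b^v_r + (r / v) * b^t_v. The former is
    independent of (W_v, W_t - W_v) by induction, and the rotation makes the
    latter independent of W_t. *)
Let bridge_independent_seq L : forall t, path >%R t L -> all (> 0) (t :: L) ->
  forall E, sigma_process (bridge W t) [set` L] E ->
  forall A, measurable A ->
  P (E `&` W t @^-1` A) = (P E * normal_prob 0 (Num.sqrt t) A)%E.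
Proof.
elim: L => [t _ /= /andP[t0 _] E sE A mA|
  v L IH t /= /andP[vt vL] /andP[t0 /= vL0] E sE A mA].
  rewrite -(brownian_marginal t0 mA).
  move: E sE; apply: independent_pi_system.
  - by move=> ? [].
  - by move=> ? ? [].
  - by apply: mWB => //; exact: ltW.
  - by move=> ? [].
have v0 : 0 < v by case/andP: vL0.
have past_v D : sigma_process (bridge W v) [set` L] D -> sigma_process W `[0, v] D.
  apply: bridge_past => r rL.
  move: vL0 => /andP[_ /allP/(_ r rL) r0]; rewrite ltW//=.
  have gt_trans : transitive (>%R : rel R).
    by move=> y x z xy yz; exact: lt_trans yz xy.
  have := order_path_min gt_trans vL => /allP/(_ r rL)/ltW//.
have rot D : sigma_process (bridge W v) [set` L] D -> forall A B,
    measurable A -> measurable B ->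
    P (D `&` (W t @^-1` A `&` bridge W t v @^-1` B)) =
    (P D * (normal_prob 0 (Num.sqrt t) A *
            normal_prob 0 (Num.sqrt (v * (t - v) / t)) B))%E.
  move=> sD; apply: bridge_rotation => //; first exact: past_v.
  by move=> ? ?; exact: (IH v).
rewrite -(brownian_marginal t0 mA).
have mbB B : measurable B -> measurable (bridge W t v @^-1` B).
  move=> mB; rewrite -[X in measurable X]setTI.
  by apply: measurable_bridge => //; exact: ltW.
pose C := [set D `&` bridge W t v @^-1` B |
  D in sigma_process (bridge W v) [set` L] & B in measurable].
have mbv : measurable_fun setT (bridge W t v : g_sigma_algebraType C -> R).
  apply/sigma_rvP => _ [B mB <-]; apply: sub_sigma_algebra.
  by exists setT; [exact: (@measurableT _ (g_sigma_algebraType _))|exists B].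
apply: (@independent_pi_system _ _ _ _ C).
- move=> _ [D sD [B mB <-]]; apply: measurableI; last exact: mbB.
  exact: (past_measurable (past_v D sD)).
- move=> _ _ [D1 sD1 [B1 mB1 <-]] [D2 sD2 [B2 mB2 <-]].
  exists (D1 `&` D2); first exact: (@measurableI _ (g_sigma_algebraType
    (\bigcup_(s in [set` L]) sigma_rv (bridge W v s))) _ _ sD1 sD2).
  by exists (B1 `&` B2); [exact: measurableI|rewrite preimage_setI setIACA].
- by apply: mWB => //; exact: ltW.
- move=> _ [D sD [B mB <-]].
  rewrite -setIA [X in D `&` X]setIC rot// brownian_marginal//.
  have := rot D sD setT B measurableT mB.
  rewrite preimage_setT setTI probability_setT mul1e => ->.
  have mulCA (x y z : \bar R) : (x * (y * z) = x * z * y)%E.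
    by rewrite muleA muleAC.
  exact: mulCA.
- move: E sE; apply: sigma_process_min => r /=; rewrite inE => /orP[/eqP -> //|rL].
  rewrite (_ : bridge W t r =
      fun w => bridge W v r w + r / v * bridge W t v w); last first.
    apply/funext => w; rewrite /bridge; field.
    by rewrite !gt_eqF.
  apply: measurable_funD; last exact: measurable_funM.
  apply/sigma_rvP => D bD; apply: sub_sigma_algebra; exists D.
    by apply: sub_sigma_algebra; exists r.
  by exists setT => //; rewrite preimage_setT setIT.
Qed.

Lemma bridge_independent t E A : 0 < t ->
  sigma_process (bridge W t) `]0, t[ E -> measurable A ->
  P (E `&` W t @^-1` A) = (P E * normal_prob 0 (Num.sqrt t) A)%E.
Proof.
move=> t0 sE mA; rewrite -(brownian_marginal t0 mA).
move: E sE; apply: independent_sigma_process.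
- move=> s /=; rewrite in_itv/= => /andP[s0 st].
  by apply: measurable_bridge; exact: ltW.
- by apply: mWB => //; exact: ltW.
- move=> L sL LI E sE; rewrite brownian_marginal//.
  apply: bridge_independent_seq sE _ mA.
    rewrite path_min_sorted//; apply/allP => s /LI/=.
    by rewrite in_itv/= => /andP[].
  rewrite /= t0/=; apply/allP => s /LI/=.
  by rewrite in_itv/= => /andP[].
Qed.

(** The bridge of length r at time t is a combination of W_t and W_r - W_t, to
    which the bridge of length t is jointly independent. *)
Lemma bridge_independent_future t r E A : 0 < t -> t < r ->
  sigma_process (bridge W t) `]0, t[ E -> measurable A ->
  P (E `&` bridge W r t @^-1` A) =
  (P E * normal_prob 0 (Num.sqrt (t * (r - t) / r)) A)%E.
Proof.
move=> t0 tr sE mA.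
have := @bridge_rotation t r E t0 tr _ _ setT A measurableT mA.
rewrite preimage_setT setTI probability_setT mul1e; apply.
- move: sE; apply: bridge_past => s /=.
  by rewrite in_itv/= => /andP[/ltW -> /ltW ->].
- by move=> B mB; exact: bridge_independent.
Qed.

End brownian_bridge.

(** * Joint measurability of the paths and the law of (tau, W) *)

Lemma measurable_invr (R : realType) : measurable_fun setT (@GRing.inv R).
Proof.
(* Power functions are measurable, and powers to the -1 vanish at 0. *)
rewrite (_ : @GRing.inv R =
    fun x => Num.max x 0 `^ (-1) - Num.max (- x) 0 `^ (-1)).
  by apply: measurable_funB; apply: (measurableT_comp (measurable_powR _));
    apply: measurable_maxr => //; exact: oppr_measurable.
apply/funext => x; have [x0|x0] := leP 0 x.
  have -> : Num.max (- x) 0 = 0 by apply/max_idPr; rewrite oppr_le0.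
  by rewrite !powR_inv1// invr0 subr0.
have -> : Num.max (- x) 0 = - x by apply/max_idPl; rewrite oppr_ge0 ltW.
rewrite powR_inv1// powR_inv1; last by rewrite oppr_ge0 ltW.
by rewrite invr0 sub0r invrN opprK.
Qed.

Section path_measurability.
Context d (T : measurableType d) (R : realType).
Variables (W : R -> T -> R).
Hypothesis cW : forall w, {within `[0, +oo[, continuous (fun t => W t w)}.

(** Generators of sigma(W). The sample space with this coarser sigma-algebra is
    the path space, on which the identity of the sample space is independent of
    any tau independent of W. *)
Definition path_events := \bigcup_(s in `[0, +oo[) sigma_rv (W s).

(** Time rounded down to a multiple of 1 / (n + 1), so that only countably many
    variables W_s occur in each approximation. *)
Let step n (x : R) := (Num.trunc (Num.max x 0 * n.+1%:R))%:R / n.+1%:R : R.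

Let cvg_step x : step n x @[n --> \oo] --> Num.max x 0.
Proof.
have x0 : 0 <= Num.max x 0 by rewrite le_max lexx orbT.
have h : (Num.max x 0 - n.+1%:R^-1) @[n --> \oo] --> Num.max x 0.
  rewrite -[X in _ --> X]subr0; apply: cvgB; first exact: cvg_cst.
  exact: cvg_harmonic.
apply: (squeeze_cvgr _ h (cvg_cst _)); apply: nearW => n.
have n0 : 0 < n.+1%:R :> R by rewrite ltr0n.
have /andP[l u] := truncn_itv (mulr_ge0 x0 (ltW n0)).
rewrite /step ler_pdivrMr// l andbT ler_pdivlMr// mulrBl mulVf ?gt_eqF//.
by rewrite lerBlDr natr1 ltW.
Qed.

(** The maximum extends the paths to negative times by their value at 0. *)
Lemma measurable_path :
  measurable_fun setT
    (fun z : R * g_sigma_algebraType path_events => W (Num.max z.1 0) z.2).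
Proof.
pose h n (z : R * g_sigma_algebraType path_events) := W (step n z.1) z.2.
have step0 n x : 0 <= step n x by rewrite divr_ge0.
apply: (@measurable_fun_cvg _ _ _ setT h).
- move=> n _ B mB; rewrite setTI.
  have -> : h n @^-1` B = \bigcup_k
      ([set r | Num.trunc (Num.max r 0 * n.+1%:R) = k] `*`
       W (k%:R / n.+1%:R) @^-1` B).
    apply/seteqP; split=> [[r w] /= Bw|[r w] [k _ [/= <-]]//].
    by exists (Num.trunc (Num.max r 0 * n.+1%:R)).
  apply: bigcupT_measurable => k; apply: measurableX.
    rewrite (_ : [set r | _] =
        (fun r => Num.max r 0 * n.+1%:R) @^-1` `[k%:R, k.+1%:R[).
      rewrite -[X in measurable X]setTI.
      have m : measurable_fun setT (fun r : R => Num.max r 0 * n.+1%:R).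
        by apply: measurable_funM => //; exact: measurable_maxr.
      exact: m.
    apply/funext => r; apply/propext; rewrite /= in_itv/=.
    rewrite -truncn_eq; first by split=> /eqP.
    by rewrite mulr_ge0// le_max lexx orbT.
  apply: sub_sigma_algebra; exists (k%:R / n.+1%:R).
    by rewrite /= in_itv/= andbT divr_ge0.
  by exists B => //; rewrite setTI.
- move=> [r w] _; rewrite /h/=.
  have r0 : `[0, +oo[%classic (Num.max r 0).
    by rewrite /= in_itv/= andbT le_max lexx orbT.
  have cr := (@subspace_continuousP _ _ _ (fun t => W t w)).1 (@cW w) _ r0.
  have cs := @cvg_step r.
  apply: cvg_trans cr => U UW.
  have {}cs : \forall n \near \oo,
      `[0, +oo[%classic (step n r) -> U (W (step n r) w).
    exact: (cs _ UW).
  suff : \forall n \near \oo, U (W (step n r) w) by [].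
  apply: filterS cs => n /=; apply.
  by rewrite in_itv/= step0.
Qed.

End path_measurability.

Section joint_law.
Context d (T : measurableType d) (R : realType) (P : probability T R).
Variables (W : R -> T -> R) (tau : {RV P >-> R}).
Hypothesis mW : forall s, 0 <= s -> measurable_fun setT (W s).
Hypothesis tauW :
  independent_systems P (sigma_rv tau) (sigma_process W `[0, +oo[).

Let path_space := g_sigma_algebraType (path_events W).

(** By independence, the pair formed by tau and the path has a product law, so
    tau may be frozen at r. *)
Lemma joint_law (D : set (R * path_space)) : measurable D ->
  P ((fun w => (tau w, w)) @^-1` D) =
  (\int[distribution P tau]_r P (xsection D r))%E.
Proof.
move=> mD.
have sm : sigma_process W `[0, +oo[ `<=` measurable.
  apply: sigma_process_measurable => s /=; rewrite in_itv/= andbT; exact: mW.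
have mid : measurable_fun setT (idfun : T -> path_space).
  by move=> _ B mB; rewrite setTI; exact: sm.
pose idm : {mfun T >-> path_space} :=
  HB.pack (idfun : T -> path_space) (isMeasurableFun.Build _ _ _ _ _ mid).
have mpair : measurable_fun setT ((fun w => (tau w, w)) : T -> R * path_space).
  exact: measurable_fun_pair.
apply/esym.
apply: (@product_measure_unique _ _ _ _ R (distribution P tau)
  (distribution P idm) (pushforward_measure P mpair)) => //.
move=> A B mA mB; apply: tauW; last exact: mB.
by exists A => //; rewrite setTI.
Qed.

End joint_law.

(** * The joint law of tau and the information process *)

Section phi.
Context {R : realType}.
Implicit Types t r x : R.

Lemma phi_normal t r x : 0 < t -> t < r ->
  phi t r x = normal_pdf 0 (Num.sqrt (t * (r - t) / r)) x.
Proof.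
move=> t0 tr; rewrite /phi t0 tr/= /gauss_density normal_pdf_sqrt; last first.
  by rewrite divr_gt0 ?mulr_gt0 ?subr_gt0// (lt_trans t0).
by rewrite subr0; congr ((Num.sqrt _)^-1 * expR (_ / _)); ring.
Qed.

Lemma phi_ge0 t r x : 0 <= phi t r x.
Proof.
by rewrite /phi; case: ifP => // _; rewrite mulr_ge0 ?expR_ge0//.
Qed.

Lemma measurable_phi t : measurable_fun setT (fun z : R * R => phi t z.1 z.2).
Proof.
have m1 := @measurable_fst _ _ R R.
have m2 := @measurable_snd _ _ R R.
apply: measurable_fun_ifT; last exact: measurable_cst.
  apply: measurable_and; last exact: measurable_fun_ltr.
  exact: measurable_fun_ltr.
have mv : measurable_fun setT (fun z : R * R => t * (z.1 - t) / z.1).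
  apply: measurable_funM; last exact: (measurableT_comp (@measurable_invr R) m1).
  by apply: measurable_funM => //; exact: measurable_funB.
have ms : measurable_fun setT
    (fun z : R * R => Num.sqrt (2 * pi * (t * (z.1 - t) / z.1))).
  have mv' : measurable_fun setT
      (fun z : R * R => 2 * pi * (t * (z.1 - t) / z.1)).
    exact: measurable_funM.
  exact: (measurableT_comp (continuous_measurable_fun (@sqrt_continuous R)) mv').
apply: measurable_funM.
  exact: (measurableT_comp (@measurable_invr R) ms).
apply: measurableT_comp => //; apply: measurable_funM.
  by apply: measurable_funN; apply: measurable_funX; exact: measurable_funB.
have m2v : measurable_fun setT (fun z : R * R => 2 * (t * (z.1 - t) / z.1)).
  exact: measurable_funM.
exact: (measurableT_comp (@measurable_invr R) m2v).
Qed.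

End phi.

Section information.
Context d (T : measurableType d) (R : realType) (P : probability T R).
Variables (W : R -> T -> R) (tau : {RV P >-> R}).
Hypothesis bW : standard_brownian P W.
Hypothesis tauW :
  independent_systems P (sigma_rv tau) (sigma_process W `[0, +oo[).
Let beta := information_process W tau.
Let mW := brownian_measurable bW.
Let Q := distribution P tau.
Notation mu := (@lebesgue_measure R).

Lemma information_bridge t w : t < tau w -> beta t w = bridge W (tau w) t w.
Proof. by rewrite /beta /information_process /bridge => /ltW/max_idPl ->. Qed.

Lemma information_after t w : 0 < t -> tau w <= t -> beta t w = 0.
Proof.
move=> t0 /max_idPr h; rewrite /beta /information_process h divff ?gt_eqF//.
by rewrite mul1r subrr.
Qed.

Lemma measurable_information t : 0 <= t -> measurable_fun setT (beta t).
Proof.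
move=> t0.
have mtau : measurable_fun setT tau by [].
have mM : measurable_fun setT (fun w => Num.max (tau w) t).
  exact: measurable_maxr.
have sm : sigma_process W `[0, +oo[ `<=` measurable.
  apply: sigma_process_measurable => s /=; rewrite in_itv/= andbT; exact: mW.
have mp : measurable_fun setT
    (fun w => (Num.max (tau w) t, w) : R * g_sigma_algebraType (path_events W)).
  apply: measurable_fun_pair => //.
  by move=> _ B mB; rewrite setTI; exact: sm.
apply: measurable_funB; first exact: mW.
apply: measurable_funM.
  apply: measurable_funM => //; exact: (measurableT_comp (@measurable_invr R) mM).
have := measurableT_comp (measurable_path (brownian_continuous bW)) mp.
rewrite (_ : _ \o _ = (fun w => W (Num.max (tau w) t) w))//.
apply/funext => w /=; congr (W _ w); apply/max_idPl.
by rewrite le_max t0 orbT.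
Qed.

(** For t < tau = r, the information process at t is the bridge of length r,
    which is independent of E. *)
Lemma bridge_law_at_tau (t : R) (E : set T) (A B : set R) :
  0 < t -> measurable A -> measurable B -> B `<=` `]t, +oo[ ->
  sigma_process (bridge W t) `]0, t[ E ->
  P (E `&` (tau @^-1` B `&` beta t @^-1` A)) =
  (\int[Q]_(r in B) (P E * normal_prob 0 (Num.sqrt (t * (r - t) / r)) A))%E.
Proof.
move=> t0 mA mB Bt sE.
have sE' : sigma_process W `[0, +oo[ E.
  move: sE => /(bridge_past _) sE.
  have : sigma_process W `[0, t] E.
    by apply: sE => s /=; rewrite in_itv/= => /andP[/ltW -> /ltW ->].
  apply: sub_sigma_algebra2; apply: bigcup_subset => s /=.
  by rewrite !in_itv/= => /andP[->].
pose D : set (R * g_sigma_algebraType (path_events W)) :=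
  (B `*` E) `&` (fun z => W t z.2 - t / z.1 * W (Num.max z.1 0) z.2) @^-1` A.
have mD : measurable D.
  apply: measurableI; first exact: measurableX.
  rewrite -[X in measurable X]setTI.
  have m : measurable_fun setT (fun z : R * g_sigma_algebraType (path_events W) =>
      W t z.2 - t / z.1 * W (Num.max z.1 0) z.2).
    apply: measurable_funB.
      apply: (measurableT_comp _ measurable_snd).
      by apply: measurable_sigma_process; rewrite /= in_itv/= ltW.
    apply: measurable_funM; last exact: (measurable_path (brownian_continuous bW)).
    apply: measurable_funM => //.
    exact: (measurableT_comp (@measurable_invr R) measurable_fst).
  exact: m.
have Bgt r : B r -> t < r by move=> /Bt; rewrite /= in_itv/= andbT.
transitivity (P ((fun w => (tau w, w)) @^-1` D)).
  congr (P _); apply/seteqP; split=> w /=.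
    move=> [Ew [Bw Aw]]; split => //=.
    have tw := Bgt _ Bw.
    by rewrite (max_idPl (ltW (lt_trans t0 tw))) -[_ - _]information_bridge.
  move=> [[/= Bw Ew]] /=; have tw := Bgt _ Bw.
  by rewrite (max_idPl (ltW (lt_trans t0 tw))) -[_ - _]information_bridge.
rewrite (joint_law mW tauW mD) [RHS]integral_mkcond.
apply: eq_integral => r _; rewrite /patch; case: ifPn => rB; last first.
  rewrite (_ : xsection D r = set0) ?measure0//.
  apply/seteqP; split => // w; rewrite /xsection/= inE => -[[/= Br _] _].
  by move/negP: rB; rewrite inE.
move: rB; rewrite inE => rB; have tr := Bgt _ rB.
rewrite -(bridge_independent_future bW t0 tr sE mA); congr (P _).
apply/seteqP; split=> w; rewrite /xsection/= inE.
  by move=> [[/= _ Ew]] /=; rewrite (max_idPl (ltW (lt_trans t0 tr))).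
by move=> [Ew Aw]; split => //=; rewrite (max_idPl (ltW (lt_trans t0 tr))).
Qed.

(** The density at x of the law of beta_t on the event {tau in B}. *)
Definition bridge_mixture (t : R) (B : set R) (x : R) : \bar R :=
  (\int[Q]_(r in B) (phi t r x)%:E)%E.

Lemma measurable_bridge_mixture t B : measurable B ->
  measurable_fun setT (bridge_mixture t B).
Proof.
move=> mB.
pose f (z : R * R) := (phi t z.1 z.2 * \1_B z.1)%:E.
have mf : measurable_fun setT f.
  apply/measurable_EFinP; apply: measurable_funM; first exact: measurable_phi.
  exact: (measurableT_comp
      (measurable_indic mB : measurable_fun setT (\1_B : R -> R)) measurable_fst).
have f0 z : (0 <= f z)%E by rewrite lee_fin mulr_ge0// phi_ge0.
rewrite (_ : bridge_mixture t B = fun x => \int[Q]_r f (r, x))%E.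
  exact: (@measurable_fun_fubini_tonelli_G _ _ _ _ R Q f).
apply/funext => x; rewrite /bridge_mixture integral_mkcond.
apply: eq_integral => r _.
by rewrite /patch /f/= indicE; case: ifP; rewrite ?mulr1 ?mulr0.
Qed.

Lemma bridge_mixture_ge0 t B x : (0 <= bridge_mixture t B x)%E.
Proof. by apply: integral_ge0 => r _; rewrite lee_fin phi_ge0. Qed.

(** The density [phi t r] of the bridge of length r, integrated over r; Tonelli's
    theorem exchanges r and x. *)
Lemma joint_density (t : R) (E : set T) (A B : set R) :
  0 < t -> measurable A -> measurable B -> B `<=` `]t, +oo[ ->
  sigma_process (bridge W t) `]0, t[ E ->
  P (E `&` (tau @^-1` B `&` beta t @^-1` A)) =
  (P E * \int[mu]_(x in A) bridge_mixture t B x)%E.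
Proof.
move=> t0 mA mB Bt sE; rewrite bridge_law_at_tau//.
have Bgt r : B r -> t < r by move=> /Bt; rewrite /= in_itv/= andbT.
have mf : measurable_fun setT
    (fun z : R * R => (phi t z.1 z.2 * \1_B z.1 * \1_A z.2)%:E).
  apply/measurable_EFinP; apply: measurable_funM.
    apply: measurable_funM; first exact: measurable_phi.
    exact: (measurableT_comp
      (measurable_indic mB : measurable_fun setT (\1_B : R -> R)) measurable_fst).
  exact: (measurableT_comp
    (measurable_indic mA : measurable_fun setT (\1_A : R -> R)) measurable_snd).
pose f : R * measurableTypeR R -> \bar R :=
  fun z => (phi t z.1 z.2 * \1_B z.1 * \1_A z.2)%:E.
have mf' : measurable_fun setT f by exact: mf.
have f0 z : (0 <= f z)%E by rewrite lee_fin !mulr_ge0// phi_ge0.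
have L :
    (\int[Q]_(r in B) (P E * normal_prob 0 (Num.sqrt (t * (r - t) / r)) A) =
    \int[Q]_r (P E * \int[mu]_x f (r, x)))%E.
  rewrite integral_mkcond; apply: eq_integral => r _; rewrite /patch.
  case: ifPn => rB; last first.
    rewrite integral0_eq ?mule0// => x _.
    by rewrite /f/= indicE (negbTE rB) mulr0 mul0r.
  congr (_ * _)%E; rewrite /normal_prob integral_mkcond; apply: eq_integral => x _.
  rewrite /patch /f/= !indicE rB mulr1; case: ifP => _; rewrite ?mulr1 ?mulr0//.
  by rewrite phi_normal//; apply: Bgt; rewrite inE in rB.
have mI : measurable_fun setT (fun r => \int[mu]_x f (r, x))%E.
  exact: (@measurable_fun_fubini_tonelli_F _ _ _ _ R mu f).
have I0 r : setT r -> (0 <= \int[mu]_x f (r, x))%E.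
  by move=> _; exact: integral_ge0.
rewrite L (ge0_integralZl Q measurableT mI I0); last exact: measure_ge0.
congr (_ * _)%E.
rewrite (@fubini_tonelli _ _ _ _ R Q mu f mf' f0).
rewrite [RHS]integral_mkcond; apply: eq_integral => x _; rewrite /patch.
case: ifPn => xA; last first.
  by apply: integral0_eq => r _; rewrite /f/= [X in _ * X]indicE (negbTE xA) mulr0.
rewrite /bridge_mixture [RHS]integral_mkcond; apply: eq_integral => r _.
rewrite /patch /f/= [X in _ * X]indicE xA mulr1 indicE.
by case: ifP; rewrite ?mulr1 ?mulr0.
Qed.

End information.

(** * Bayes' rule *)

Section conditional_density.
Context d (T : measurableType d) (R : realType) (P : probability T R).
Variables (X : T -> R) (C : set (set T)).
Hypotheses (mX : measurable_fun setT X) (mC : <<s C >> `<=` measurable).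
Local Open Scope ereal_scope.
Notation mu := (@lebesgue_measure R).

(** On the event F the variable X has the (unnormalized) density f, and it is
    there independent of the sigma-algebra generated by C. *)
Definition has_conditional_density (F : set T) (f : R -> R) :=
  [/\ measurable F, measurable_fun setT f, (forall x, 0 <= f x)%R &
    forall E A, <<s C >> E -> measurable A ->
    P (E `&` (F `&` X @^-1` A)) = P E * \int[mu]_(x in A) (f x)%:E].

Let S := g_sigma_algebraType C.

Let mid : measurable_fun setT (idfun : T -> S).
Proof. by move=> _ B mB; rewrite setTI; exact: mC. Qed.

Let idm : {mfun T >-> S} :=
  HB.pack (idfun : T -> S) (isMeasurableFun.Build _ _ _ _ _ mid).

(** Under P restricted to F, the pair of X and the sample point, the latter seen
    through sigma(C), has the product of f dx and P as its law. *)
Lemma ge0_integral_conditional_density F f (h : R * S -> \bar R) :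
  has_conditional_density F f ->
  measurable_fun setT h -> (forall z, 0 <= h z) ->
  \int[P]_(w in F) h (X w, w) =
  \int[mu]_x ((\int[distribution P idm]_w h (x, w)) * (f x)%:E).
Proof.
move=> [mF mf f0 FE] mh h0.
pose X' : T -> measurableTypeR R := X.
have mX' : measurable_fun setT X' by exact: mX.
pose h' : measurableTypeR R * S -> \bar R := h.
have mh' : measurable_fun setT h' by exact: mh.
pose Phi : T -> measurableTypeR R * S := fun w => (X w, w).
have mPhi : measurable_fun setT Phi.
  by apply: measurable_fun_pair; [exact: mX'|exact: mid].
pose PF : {measure set T -> \bar R} := mrestr P mF.
pose nu0 := pushforward_measure PF mX'.
have fin_nu : fin_num_fun nu0.
  move=> A mA; rewrite /nu0/= /pushforward /mrestr/= fin_num_measure//.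
  have mXA : measurable (X @^-1` A).
    by rewrite -[Y in measurable Y]setTI; apply: mX.
  exact: measurableI.
pose nu : {finite_measure set (measurableTypeR R) -> \bar R} :=
  HB.pack (Measure.sort nu0)
    (Measure_isFinite.Build _ _ _ (Measure.sort nu0) fin_nu).
pose m := pushforward_measure PF mPhi.
have nuE A : measurable A -> nu A = \int[mu]_(x in A) (f x)%:E.
  move=> mA; rewrite -[RHS]mul1e -(probability_setT P) -FE//; last first.
    exact: (@measurableT _ S).
  by rewrite setTI setIC.
transitivity (\int[PF]_w h (X w, w)).
  rewrite (@ge0_integral_density _ _ _ P PF (\1_F : T -> R))//.
  - rewrite [LHS]integral_mkcond; apply: eq_integral => w _; rewrite /patch indicE.
    by case: ifP; rewrite ?mule1 ?mule0.
  - move=> A mA; rewrite /PF/= /mrestr integral_indic//; congr (P _); exact: setIC.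
  - exact: (measurableT_comp mh' mPhi).
transitivity (\int[m]_z h' z).
  by rewrite (ge0_integral_pushforward mPhi)// => z _.
transitivity (\int[nu \x distribution P idm]_z h' z).
  apply: eq_measure_integral => D mD _; apply/esym.
  apply: (@product_measure_unique _ _ _ _ R nu (distribution P idm) m) => //.
  move=> A B mA mB.
  transitivity (P (B `&` (F `&` X @^-1` A))).
    by congr (P _); apply/seteqP; split=> [w [[]]|w [? []]].
  by rewrite FE// muleC -nuE.
rewrite (@fubini_tonelli1 _ _ _ _ R nu (distribution P idm) h')//.
apply: (@ge0_integral_density _ _ R mu nu f mf f0 nuE
  (fun x => \int[distribution P idm]_w h' (x, w))).
  exact: (@measurable_fun_fubini_tonelli_F _ _ _ _ R (distribution P idm) h').
by move=> x; apply: integral_ge0.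
Qed.

(** Both sides are integrals against dx: the left one has the factor f(x), the
    right one q(x) * g(x). The events of interest are described jointly by X
    and by sigma(C), hence the set D of pairs. *)
Lemma bayes_conditional_density F G (f g q : R -> R) :
  has_conditional_density F f -> has_conditional_density G g ->
  measurable_fun setT q -> (forall x, 0 <= q x)%R ->
  {ae mu, forall x, (q x * g x)%R = f x} ->
  forall D : set (R * S), measurable D ->
  P (F `&` (fun w => (X w, w)) @^-1` D) =
  \int[P]_(w in G `&` (fun w => (X w, w)) @^-1` D) (q (X w))%:E.
Proof.
move=> hF hG mq q0 qgf D mD.
have [mF mf f0 _] := hF; have [mG mg g0 _] := hG.
have mPhi : measurable_fun setT ((fun w => (X w, w)) : T -> R * S).
  by apply: measurable_fun_pair; [exact: mX|exact: mid].
have mPhiD : measurable ((fun w => (X w, w)) @^-1` D : set T).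
  by rewrite -[X in measurable X]setTI; exact: mPhi.
pose h1 (z : R * S) := (\1_D z)%:E : \bar R.
pose h2 (z : R * S) := (q z.1 * \1_D z)%:E.
have mh1 : measurable_fun setT h1 by exact/measurable_EFinP.
have mh2 : measurable_fun setT h2.
  apply/measurable_EFinP; apply: measurable_funM => //.
  exact: (measurableT_comp mq measurable_fst).
have h10 z : 0 <= h1 z by rewrite lee_fin.
have h20 z : 0 <= h2 z by rewrite lee_fin mulr_ge0.
transitivity (\int[P]_(w in F) h1 (X w, w)).
  by rewrite setIC -integral_indic//; apply: eq_integral.
transitivity (\int[P]_(w in G) h2 (X w, w)); last first.
  rewrite integral_mkcondr; apply: eq_integral => w _; rewrite /h2 /patch indicE.
  rewrite (_ : (w \in _) = ((X w, w) \in D)); last by apply/idP/idP; rewrite !inE.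
  by case: ifP; rewrite ?mulr1 ?mulr0.
rewrite (ge0_integral_conditional_density hF)//.
rewrite (ge0_integral_conditional_density hG)//.
have mh1x : measurable_fun setT (fun x => \int[distribution P idm]_w h1 (x, w)).
  exact: (@measurable_fun_fubini_tonelli_F _ _ _ _ R (distribution P idm) h1).
have mh2x : measurable_fun setT (fun x => \int[distribution P idm]_w h2 (x, w)).
  exact: (@measurable_fun_fubini_tonelli_F _ _ _ _ R (distribution P idm) h2).
apply: ae_eq_integral => //.
- by apply: emeasurable_funM => //; exact/measurable_EFinP.
- by apply: emeasurable_funM => //; exact/measurable_EFinP.
apply: (@filterS _ _ (ae_filter_ringOfSetsType mu) _ _ _ qgf) => x qgfx _.
have -> : \int[distribution P idm]_w h2 (x, w) =
    (q x)%:E * \int[distribution P idm]_w h1 (x, w).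
  rewrite -ge0_integralZl//; last by rewrite lee_fin.
  exact: (measurableT_comp mh1 (pair1_measurable x)).
by rewrite -qgfx EFinM muleA [X in X * _ = _]muleC.
Qed.

End conditional_density.

Section distribution_function_measure.
Context d (T : measurableType d) (R : realType) (P : probability T R).
Variable X : {RV P >-> R}.
Local Open Scope ereal_scope.
Let dF := lebesgue_stieltjes_measure (distribution_function X).

Let X' : T -> measurableTypeR R := X.

Let mX' : measurable_fun setT X'.
Proof. exact: (measurable_funPT X). Qed.

Let Q' := pushforward_measure P mX'.

Lemma distribution_function_measure (A : set R) : measurable A ->
  dF A = P (X @^-1` A).
Proof.
move=> mA.
apply: (@lebesgue_stieltjes_measure_unique _ (distribution_function X) Q' _ A mA).
move=> _ [[a b]]/= _ <-.
rewrite /dF /lebesgue_stieltjes_measure /measure_extension/=.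
rewrite measurable_mu_extE/=; last exact: is_ocitv.
have [ab | ba] := leP a b; last first.
  by rewrite set_itv_ge ?wlength0 ?measure0// bnd_simp -leNgt ltW.
rewrite wlength_itv_bnd// EFinB !fineK ?fin_num_measure//.
rewrite /cdf /distribution /pushforward.
have E : `]a, b]%classic = `]-oo, b] `\` `]-oo, a].
  by rewrite -[RHS]setCK setCD setCitvl setUC -[LHS]setCK setCitv.
have mXi c : measurable (X @^-1` `]-oo, c]).
  by rewrite -[Y in measurable Y]setTI; exact: (measurable_funPT X).
rewrite E (_ : X @^-1` (_ `\` _) = X @^-1` `]-oo, b] `\` X @^-1` `]-oo, a])//.
rewrite measureD//; last first.
  by rewrite -ge0_fin_numE// fin_num_measure.
by rewrite setIidr// => w /=; rewrite !in_itv/= => /le_trans; apply.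
Qed.

Lemma ge0_integral_distribution_function (D : set R) (f : R -> \bar R) :
  measurable D -> measurable_fun setT f -> (forall x, 0 <= f x) ->
  \int[dF]_(x in D) f x = \int[distribution P X]_(x in D) f x.
Proof.
move=> mD mf f0.
transitivity (\int[Q']_(x in D) f x).
  by apply: eq_measure_integral => A mA _; exact: distribution_function_measure.
rewrite (ge0_integral_pushforward mX')//; last exact: measurable_funTS.
rewrite (ge0_integral_pushforward (measurable_funPT X))//.
exact: measurable_funTS.
Qed.

End distribution_function_measure.

Section conditional_probability_unique.
Context d (T : measurableType d) (R : realType) (P : probability T R).
Variables (C : set (set T)) (mC : <<s C >> `<=` measurable) (A : set T).

(** Two versions are measurable functions on the space (T, sigma(C)) with the
    same integral over every measurable set. *)
Lemma is_cond_prob_unique (Y Z : T -> R) :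
  is_cond_prob P <<s C >> A Y -> is_cond_prob P <<s C >> A Z ->
  {ae P, forall w, Y w = Z w}.
Proof.
move=> [sY iY eY] [sZ iZ eZ].
pose S := g_sigma_algebraType C.
have mid : measurable_fun setT (idfun : T -> S).
  by move=> _ B mB; rewrite setTI; exact: mC.
pose p := pushforward_measure P mid.
have mY : measurable_fun setT (EFin \o (Y : S -> R)).
  by apply/measurable_EFinP/sigma_rvP.
have mZ : measurable_fun setT (EFin \o (Z : S -> R)).
  by apply/measurable_EFinP/sigma_rvP.
have YZ : ae_eq p setT (EFin \o (Y : S -> R)) (EFin \o (Z : S -> R)).
  apply: integral_ae_eq => //.
    exact: (@integrable_pushforward _ _ _ _ _ _ mid P setT).
  move=> E _ mE.
  rewrite [LHS](integral_pushforward mid)//; last first.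
    by apply: (integrableS measurableT _ _ iY) => //; exact: mC.
  rewrite [RHS](integral_pushforward mid)//; last first.
    by apply: (integrableS measurableT _ _ iZ) => //; exact: mC.
  by rewrite eY// eZ.
case: YZ => N [mN pN YZN]; exists N; split => //; first exact: mC.
apply: subset_trans YZN => w /= YZw H; apply: YZw.
by have := H I => -[].
Qed.

End conditional_probability_unique.

Section density_of_information.
Context d (T : measurableType d) (R : realType) (P : probability T R).
Variables (W : R -> T -> R) (tau : {RV P >-> R}).
Hypothesis bW : standard_brownian P W.
Hypothesis tauW :
  independent_systems P (sigma_rv tau) (sigma_process W `[0, +oo[).
Variables (t : R) (t0 : 0 < t).
Let beta := information_process W tau.
Notation mu := (@lebesgue_measure R).
Let C := \bigcup_(s in `]0, t[) sigma_rv (bridge W t s).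
Let mix B := bridge_mixture tau t B.

Let ae_fin B : measurable B -> B `<=` `]t, +oo[ ->
  {ae mu, forall x, mix B x \is a fin_num}.
Proof.
move=> mB Bt.
have im : mu.-integrable setT (mix B).
  apply/integrableP; split; first exact: measurable_bridge_mixture.
  under eq_integral do rewrite gee0_abs ?bridge_mixture_ge0//.
  have := joint_density bW tauW t0 measurableT mB Bt
    (@measurableT _ (g_sigma_algebraType C)).
  rewrite probability_setT mul1e => <-.
  rewrite -ge0_fin_numE// fin_num_measure// preimage_setT !(setTI, setIT).
  by rewrite -[X in measurable X]setTI; exact: (measurable_funPT tau).
have := integrable_ae measurableT im.
by apply: filterS => x /(_ I).
Qed.

(** The mixture may be infinite (for instance at x = 0), but only on a null set,
    because its integral is a probability. *)
Lemma conditional_density_mixture B : measurable B -> B `<=` `]t, +oo[ ->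
  has_conditional_density P (beta t) C (tau @^-1` B) (fun x => fine (mix B x)).
Proof.
move=> mB Bt.
have mm := measurable_bridge_mixture tau t mB.
split.
- by rewrite -[X in measurable X]setTI; exact: (measurable_funPT tau).
- exact: (measurableT_comp (fine_measurable measurableT) mm).
- by move=> x; apply: fine_ge0; exact: bridge_mixture_ge0.
- move=> E A sE mA.
  rewrite (joint_density bW tauW t0 mA mB Bt sE); congr (_ * _)%E.
  apply: ae_eq_integral => //; first exact: measurable_funTS.
    apply/measurable_EFinP; apply: measurable_funTS.
    exact: (measurableT_comp (fine_measurable measurableT) mm).
  apply: (@filterS _ _ (ae_filter_ringOfSetsType mu) _ _ _ (ae_fin mB Bt)).
  by move=> x fx _; rewrite fineK.
Qed.

(** Where the denominator vanishes, so does the numerator, as B is included in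
    B'. *)
Lemma mixture_ratio B B' : measurable B -> measurable B' -> B `<=` B' ->
  B' `<=` `]t, +oo[ ->
  {ae mu, forall x,
    fine (mix B x) / fine (mix B' x) * fine (mix B' x) = fine (mix B x)}.
Proof.
move=> mB mB' BB' B't.
apply: (@filterS _ _ (ae_filter_ringOfSetsType mu) _ _ _ (ae_fin mB' B't)).
move=> x fx.
have BB'x : (mix B x <= mix B' x)%E.
  apply: ge0_subset_integral => //.
    apply/measurable_EFinP; apply: measurable_funTS.
    exact: (measurableT_comp (measurable_phi t) (pair2_measurable x)).
  by move=> r _; rewrite lee_fin phi_ge0.
have fBx : mix B x \is a fin_num.
  rewrite ge0_fin_numE ?bridge_mixture_ge0//; apply: le_lt_trans BB'x _.
  by rewrite -ge0_fin_numE ?bridge_mixture_ge0.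
have [z|nz] := eqVneq (fine (mix B' x)) 0; last by rewrite divfK.
rewrite z invr0 mulr0; apply/esym/eqP; rewrite eq_le; apply/andP; split.
  by rewrite -z; exact: fine_le.
by apply: fine_ge0; exact: bridge_mixture_ge0.
Qed.

End density_of_information.

(** * The completed filtration of the information process *)

Section filtration.
Context d (T : measurableType d) (R : realType) (P : probability T R).
Variables (W : R -> T -> R) (tau : {RV P >-> R}).
Hypothesis cP : measure_is_complete P.
Hypothesis bW : standard_brownian P W.
Hypothesis tauW :
  independent_systems P (sigma_rv tau) (sigma_process W `[0, +oo[).
Variables (t : R) (t0 : 0 < t).
Let beta := information_process W tau.
Notation mu := (@lebesgue_measure R).
Let C := \bigcup_(s in `]0, t[) sigma_rv (bridge W t s).
Let gen := \bigcup_(s in `[0, t]) sigma_rv (beta s) `|` P.-negligible.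

Let mtau B : measurable B -> measurable (tau @^-1` B).
Proof.
by move=> mB; rewrite -[X in measurable X]setTI; exact: (measurable_funPT tau).
Qed.

Lemma completed_filtration_measurable : <<s gen >> `<=` measurable.
Proof.
apply: smallest_sub; first exact: sigma_algebra_measurable.
move=> A [[s /=]|/cP//]; rewrite in_itv/= => /andP[s0 _] [B mB <-].
exact: (measurable_information tau bW s0).
Qed.

Let measurable_beta s : 0 <= s -> s <= t ->
  measurable_fun setT (beta s : g_sigma_algebraType gen -> R).
Proof.
move=> s0 st; apply/sigma_rvP => A bA; apply: sub_sigma_algebra; left.
by exists s => //=; rewrite in_itv/= s0.
Qed.

(** On {s < tau} the law of beta_s has a density. *)
Lemma information_zero_negligible s : 0 < s ->
  P.-negligible ((beta s @^-1` [set 0]) `&` (tau @^-1` `]s, +oo[)).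
Proof.
move=> s0.
have mb : measurable (beta s @^-1` [set 0]).
  rewrite -[X in measurable X]setTI.
  by apply: (measurable_information tau bW (ltW s0)) => //; exact: measurable_set1.
have H := joint_density bW tauW s0 (measurable_set1 0) (measurable_itv `]s, +oo[)
  (@subset_refl _ _) (@measurableT _ (g_sigma_algebraType _)).
have mN : measurable (beta s @^-1` [set 0] `&` tau @^-1` `]s, +oo[).
  by apply: measurableI => //; exact: mtau.
apply/negligibleP; first exact: mN.
rewrite -[RHS](mule0 (P setT)) setIC.
rewrite setTI in H; apply: (etrans H); congr (_ * _)%E.
apply: null_set_integral.
- exact: measurable_set1.
- by apply: measurable_funTS; exact: measurable_bridge_mixture.
- exact: lebesgue_measure_set1.
Qed.

(** Up to the null event above, tau <= s means that beta_s = 0. *)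
Lemma filtration_tau_le s : 0 < s -> s <= t ->
  <<s gen >> [set w | tau w <= s].
Proof.
move=> s0 st.
have -> : [set w | tau w <= s] = (beta s @^-1` [set 0]) `\`
    ((beta s @^-1` [set 0]) `&` (tau @^-1` `]s, +oo[)).
  apply/seteqP; split=> w /=.
    move=> ts; split; first exact: information_after.
    by rewrite in_itv/= andbT => -[_]; rewrite ltNge ts.
  rewrite in_itv/= andbT => -[b0 nb]; rewrite leNgt; apply/negP => st'.
  exact: nb.
apply: (@measurableD _ (g_sigma_algebraType gen)).
  have := measurable_beta (ltW s0) st measurableT (measurable_set1 0).
  by rewrite setTI.
by apply: sub_sigma_algebra; right; exact: information_zero_negligible.
Qed.

Let S := g_sigma_algebraType C.

(** On {t < tau}, beta_s = b_s + (s / t) * beta_t for s <= t, so the past of beta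
    is a function of beta_t and of the bridge b of length t. *)
Lemma filtration_trace B : <<s gen >> B ->
  exists2 D : set (R * S), measurable D &
    {ae P, forall w, t < tau w -> (B w <-> D (beta t w, w))}.
Proof.
pose H := [set B | exists2 D : set (R * S), measurable D &
    {ae P, forall w, t < tau w -> (B w <-> D (beta t w, w))}].
suff : <<s gen >> `<=` H by apply.
apply: smallest_sub.
  split.
  - by exists set0 => //; exact: aeW.
  - move=> A [D mD h]; exists (~` D); first exact: measurableC.
    apply: filterS h => w h tw; have := h tw; rewrite setTD /=.
    by move=> [h1 h2]; split; apply: contra_not.
  - move=> F /(_ _)/cid2-/all_sig2[D mD h]; exists (\bigcup_n D n).
      exact: bigcupT_measurable.
    have : {ae P, forall w, forall n,
        t < tau w -> (F n w <-> D n (beta t w, w))}.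
      by apply/ae_foralln.
    apply: filterS => w h' tw; split=> -[n _ /(h' n tw) ?]; by exists n.
move=> A [[s /=]|nA]; last first.
  exists set0 => //; apply: (negligibleS _ nA) => w /= h.
  apply: contrapT => nAw; apply: h => _; by split.
rewrite in_itv/= => /andP[s0 st] [B' mB <-].
have mb : measurable_fun setT (bridge W t s : S -> R).
  have [s00|s00] := eqVneq s 0.
    rewrite (_ : bridge W t s = cst 0); first exact: measurable_cst.
    by apply/funext => w; rewrite /bridge s00 (brownian_start bW) !mul0r subrr.
  have [stt|stt] := eqVneq s t.
    rewrite (_ : bridge W t s = cst 0); first exact: measurable_cst.
    by apply/funext => w; rewrite /bridge stt divff ?gt_eqF// mul1r subrr.
  apply: measurable_sigma_process; rewrite /= in_itv/=.
  by rewrite !lt_neqAle eq_sym s00 s0 stt st.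
have mf : measurable_fun setT (fun z : R * S => bridge W t s z.2 + s / t * z.1).
  apply: measurable_funD; first exact: (measurableT_comp mb measurable_snd).
  by apply: measurable_funM => //; exact: measurable_fst.
exists ((fun z : R * S => bridge W t s z.2 + s / t * z.1) @^-1` B').
  by rewrite -[X in measurable X]setTI; exact: mf.
apply: aeW => w tw /=.
suff -> : bridge W t s w + s / t * beta t w = beta s w.
  by rewrite /preimage/=; tauto.
rewrite /beta (information_bridge W tw).
rewrite (information_bridge W (le_lt_trans st tw)) /bridge; field.
by rewrite !gt_eqF// (lt_trans t0 tw).
Qed.

Variable u : R.
Let mix B := bridge_mixture tau t B.
Definition posterior (x : R) : R :=
  fine (mix `]t, u] x) / fine (mix `]t, +oo[ x).

Lemma posterior_ge0 x : 0 <= posterior x.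
Proof. by rewrite divr_ge0// fine_ge0// bridge_mixture_ge0. Qed.

Lemma measurable_posterior : measurable_fun setT posterior.
Proof.
have m B : measurable B -> measurable_fun setT (fun x => fine (mix B x)).
  move=> mB.
  exact: (measurableT_comp (fine_measurable measurableT)
    (measurable_bridge_mixture tau t mB)).
apply: measurable_funM; first exact: m.
exact: (measurableT_comp (@measurable_invr R) (m _ (measurable_itv _))).
Qed.

Let ut : `]t, u]%classic `<=` `]t, +oo[%classic.
Proof. by move=> x /=; rewrite !in_itv/= andbT => /andP[]. Qed.

(** Bayes' rule applies to the sets D of the previous lemma, and B agrees almost
    surely with the corresponding event on {t < tau}. *)
Lemma integral_posterior B : <<s gen >> B ->
  (\int[P]_(w in B) (posterior (beta t w) * \1_[set w | (t < tau w)%R] w)%:E =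
   P (tau @^-1` `]t, u] `&` B))%E.
Proof.
move=> sB; have mB := completed_filtration_measurable sB.
have [D mD BD] := filtration_trace sB.
have mbeta := measurable_information tau bW (ltW t0).
have sC : <<s C >> `<=` measurable.
  apply: sigma_process_measurable => s /=; rewrite in_itv/= => /andP[s0 _].
  by apply: (measurable_bridge bW); exact: ltW.
have mPhi : measurable_fun setT ((fun w => (beta t w, w)) : T -> R * S).
  apply: measurable_fun_pair; first exact: mbeta.
  by move=> _ A mA; rewrite setTI; exact: sC.
have mPhiD : measurable ((fun w => (beta t w, w)) @^-1` D : set T).
  by rewrite -[X in measurable X]setTI; exact: mPhi.
have mF : measurable (tau @^-1` `]t, u]) by exact: mtau.
have mG : measurable (tau @^-1` `]t, +oo[) by exact: mtau.
have mG' : measurable [set w | t < tau w].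
  rewrite (_ : [set w | _] = tau @^-1` `]t, +oo[)//.
  by apply/funext => w; rewrite /= in_itv/= andbT.
have mq : measurable_fun setT (fun w => posterior (beta t w)).
  exact: (measurableT_comp measurable_posterior mbeta).
have := @bayes_conditional_density _ _ _ P (beta t) C mbeta sC _ _ _ _ posterior
  (conditional_density_mixture bW tauW t0 (measurable_itv _) ut)
  (conditional_density_mixture bW tauW t0 (measurable_itv _) (@subset_refl _ _))
  measurable_posterior posterior_ge0
  (mixture_ratio bW tauW t0 (measurable_itv _) (measurable_itv _) ut
    (@subset_refl _ _)) D mD.
have -> : P (tau @^-1` `]t, u] `&` (fun w => (beta t w, w)) @^-1` D) =
    P (tau @^-1` `]t, u] `&` B).
  have indE A : measurable A -> P A = (\int[P]_w (\1_A w)%:E)%E.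
    by move=> mA; rewrite integral_indic// setIT.
  rewrite indE; last exact: measurableI.
  rewrite [RHS]indE; last exact: measurableI.
  apply: ae_eq_integral => //.
  - by apply/measurable_EFinP/measurable_indic/measurableI.
  - by apply/measurable_EFinP/measurable_indic/measurableI.
  apply: filterS BD => w BD _; congr (EFin _).
  rewrite !indicE; congr ((nat_of_bool _)%:R).
  apply/idP/idP; rewrite !inE => -[/= tw Dw]; split=> //=; apply/BD => //;
    by move: tw; rewrite in_itv/= => /andP[].
move=> ->.
rewrite integral_mkcond [RHS]integral_mkcond; apply: ae_eq_integral => //.
- apply/(measurable_restrictT _ _).1 => //.
  apply: measurable_funTS; apply/measurable_EFinP; apply: measurable_funM => //.
- apply/(measurable_restrictT _ _).1 => //; first exact: measurableI.
  by apply: measurable_funTS; exact/measurable_EFinP.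
apply: filterS BD => w BD _; rewrite /patch indicE.
have [tw|tw] := boolP (t < tau w); last first.
  rewrite (_ : (w \in [set w | t < tau w]) = false) ?mulr0; last first.
    by apply: memNset => /=; exact/negP.
  rewrite [in RHS]ifF; first by case: ifP.
  by apply/negbTE/negP; rewrite !inE/= in_itv/= andbT => -[h _]; move/negP: tw.
rewrite (_ : (w \in [set w | t < tau w]) = true) ?mulr1; last exact: mem_set.
rewrite (_ : (w \in B) = (w \in tau @^-1` `]t, +oo[ `&`
  (fun w0 => (beta t w0, w0)) @^-1` D))//.
apply/idP/idP; rewrite !inE/= in_itv/= andbT.
  by move=> /(BD tw) Dw.
by move=> [_ /(BD tw)].
Qed.

(** The event {tau <= u} splits into {tau <= min t u}, which is known at time t,
    and {t < tau <= u}, treated by Bayes' rule. *)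
Lemma posterior_is_cond_prob : 0 < u ->
  is_cond_prob P <<s gen >> [set w | tau w <= u]
    (fun w => \1_[set w' | tau w' <= Num.min t u] w +
              posterior (beta t w) * \1_[set w' | t < tau w'] w).
Proof.
move=> u0.
set Z := (X in is_cond_prob _ _ _ X).
have m0 : 0 < Num.min t u by rewrite lt_min t0.
have sm : <<s gen >> [set w' | tau w' <= Num.min t u].
  by apply: filtration_tau_le => //; rewrite ge_min lexx.
have sg : <<s gen >> [set w' | t < tau w'].
  rewrite (_ : [set w' | t < tau w'] = ~` [set w' | tau w' <= t]).
    apply: (@measurableC _ (g_sigma_algebraType gen)).
    exact: filtration_tau_le.
  by apply/funext => w; apply/propext; rewrite /= ltNge; split=> /negP.
have sZ : measurable_fun setT (Z : g_sigma_algebraType gen -> R).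
  apply: measurable_funD; first exact: measurable_indic.
  apply: measurable_funM; last exact: measurable_indic.
  exact: (measurableT_comp measurable_posterior
    (measurable_beta (ltW t0) (lexx t))).
have mZ : measurable_fun setT Z.
  by move=> mT A mA; apply: completed_filtration_measurable; exact: sZ.
have Z0 w : 0 <= Z w.
  by rewrite addr_ge0// mulr_ge0// posterior_ge0.
have ZB B : <<s gen >> B ->
    (\int[P]_(w in B) (Z w)%:E = P ([set w | (tau w <= u)%R] `&` B))%E.
  move=> sB; have mB := completed_filtration_measurable sB.
  have mm := completed_filtration_measurable sm.
  have mg := completed_filtration_measurable sg.
  have mp : measurable_fun setT (fun w => posterior (beta t w)).
    exact: (measurableT_comp measurable_posterior
      (measurable_information tau bW (ltW t0))).
  under eq_integral do rewrite EFinD.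
  have mp1 : measurable_fun B (fun w =>
      (posterior (beta t w) * \1_[set w' | t < tau w'] w)%:E).
    by apply: measurable_funTS; apply/measurable_EFinP; exact: measurable_funM.
  have mi1 : measurable_fun B
      (fun w => (\1_[set w' | tau w' <= Num.min t u] w)%:E : \bar R).
    by apply: measurable_funTS; exact/measurable_EFinP/measurable_indic.
  have p0 w : B w ->
      (0 <= (posterior (beta t w) * \1_[set w' | (t < tau w')%R] w)%:E)%E.
    by move=> _; rewrite lee_fin mulr_ge0// posterior_ge0.
  rewrite ge0_integralD//.
  rewrite integral_posterior// integral_indic// -measureU.
  - congr (P _); apply/seteqP; split=> w /=; rewrite in_itv/= le_min.
      move=> [[/andP[]//]|[/andP[_]//]].
    move=> [tu Bw]; have [tt|tt] := leP (tau w) t.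
      by left; rewrite tu.
    by right; rewrite tu.
  - exact: measurableI.
  - by apply: measurableI => //; exact: mtau.
  - apply/seteqP; split=> // w /=; rewrite in_itv/= le_min.
    by move=> [[/andP[tt _] _] [/andP[]]]; rewrite ltNge tt.
split => //.
- exact/sigma_rvP.
- apply/integrableP; split; first exact/measurable_EFinP.
  under eq_integral do rewrite /= ger0_norm//.
  rewrite ZB; last exact: (@measurableT _ (g_sigma_algebraType gen)).
  rewrite -ge0_fin_numE// fin_num_measure// setIT.
  rewrite (_ : [set w | _] = tau @^-1` `]-oo, u]); first exact: mtau.
  by apply/funext => w; rewrite /= in_itv.
Qed.

End filtration.

(** * The conditional distribution of tau *)

Theorem theorem4p1 (d : measure_display) (T : measurableType d) (R : realType)
    (P : probability T R) (W : R -> T -> R) (tau : {RV P >-> R})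
    (P_complete : measure_is_complete P)
    (W_brownian : standard_brownian P W)
    (tau_gt0 : forall w, 0 < tau w)
    (tau_W_indep :
      independent_systems P (sigma_rv tau) (sigma_process W `[0, +oo[))
    (tau_not_stopping : ~ stopping_time (completed_filtration P W) tau)
    (t : R) (t_gt0 : 0 < t) (u : R) (u_gt0 : 0 < u) :
  let beta := information_process W tau in
  let FP := completed_filtration P beta in
  let dF := lebesgue_stieltjes_measure (distribution_function tau) in
  (exists Y, is_cond_prob P (FP t) [set w | tau w <= u] Y) /\
  (forall Y, is_cond_prob P (FP t) [set w | tau w <= u] Y ->
    {ae P, forall w, Y w =
      \1_[set w' | tau w' <= Num.min t u] w +
      (\int[dF]_(r in `]t, u]) phi t r (beta t w)) /
      (\int[dF]_(v in `]t, +oo[) phi t v (beta t w)) *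
      \1_[set w' | t < tau w'] w}).
Proof.
move=> beta FP dF.
have hZ := posterior_is_cond_prob P_complete W_brownian tau_W_indep t_gt0 u_gt0.
split=> [|Y hY]; first by eexists; exact: hZ.
have mFP := @completed_filtration_measurable _ _ _ _ W tau P_complete W_brownian t.
have mixE B x : measurable B ->
    \int[dF]_(r in B) phi t r x = fine (bridge_mixture tau t B x).
  move=> mB; rewrite /Rintegral /dF ge0_integral_distribution_function//.
    apply/measurable_EFinP.
    exact: (measurableT_comp (measurable_phi t) (pair2_measurable x)).
  by move=> r; rewrite lee_fin phi_ge0.
have := is_cond_prob_unique mFP hY hZ.
apply: filterS => w ->.
by rewrite /posterior !mixE.
Qed.
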